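(* There is a sequence of real numbers $(\varepsilon_n)_{n\ge1}$ with $\varepsilon_n\to0$ as $n\to\infty$ such that for every positive integer $n$ and every integer $m>(5+\varepsilon_n)^n$ one has $\mathbb{E}^n\not\to(\ell_2,\ell_m)$.
   Context: $\mathbb{E}^n$ denotes $\mathbb{R}^n$ with the Euclidean norm. $\ell_m$ denotes a collection of $m$ points on a line with consecutive points at distance $1$. We write $\mathbb{E}^n\not\to(S_1,S_2)$ if there is a two-coloring of $\mathbb{E}^n$ (colors red and blue) with no all-red congruent copy of $S_1$ and no all-blue congruent copy of $S_2$. *)

(* Defs.v *)
From mathcomp Require Export all_boot all_order all_algebra.
From mathcomp Require Export all_classical all_reals all_analysis.
Export Order.TTheory GRing.Theory Num.Theory numFieldNormedType.Exports.

Set Implicit Arguments.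
Unset Strict Implicit.
Unset Printing Implicit Defensive.

Local Open Scope classical_set_scope.
Local Open Scope ring_scope.

(* The library's norm `|x| on 'rV[R]_n is the sup norm, hence these
   definitions for the Euclidean space E^n. *)
Definition enorm (R : realType) (n : nat) (x : 'rV[R]_n) : R :=
  Num.sqrt (\sum_(i < n) x 0 i ^+ 2).

Definition edist (R : realType) (n : nat) (x y : 'rV[R]_n) : R :=
  enorm (x - y).

(* The two sets may live in Euclidean spaces of different dimensions. *)
Definition congruent (R : realType) (n k : nat)
    (A : set 'rV[R]_n) (S : set 'rV[R]_k) : Prop :=
  exists f : 'rV[R]_k -> 'rV[R]_n,
    (forall x y, S x -> S y -> edist (f x) (f y) = edist x y) /\ f @` S = A.

Variant color := Red | Blue.

(* The relation written E^n -/-> (S1, S2) in Euclidean Ramsey theory. *)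
Definition not_arrow (R : realType) (n k1 k2 : nat)
    (S1 : set 'rV[R]_k1) (S2 : set 'rV[R]_k2) : Prop :=
  exists c : 'rV[R]_n -> color,
    (~ exists A : set 'rV[R]_n,
         congruent A S1 /\ forall x, A x -> c x = Red) /\
    (~ exists A : set 'rV[R]_n,
         congruent A S2 /\ forall x, A x -> c x = Blue).

(* The points 0, 1, ..., m - 1 of the line E^1. *)
Definition ell (R : realType) (m : nat) : set 'rV[R]_1 :=
  [set const_mx i%:R | i in [set i : nat | (i < m)%N]].
Arguments not_arrow {R} n {k1 k2} S1 S2.
Arguments ell R m : clear implicits.

(* Main.v *)
Require Import Defs.
From mathcomp Require Import zify ring lra.

Set Implicit Arguments.
Unset Strict Implicit.
Unset Printing Implicit Defensive.

(** The colouring is red exactly on balls of radius slightly below 1/2 whose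
    centres are pairwise further than 2 r + 1 apart, r being that radius: two
    points of the same ball are then at distance less than 1 and two points of
    different balls at distance more than 1, so no two red points are at
    distance 1.  The task is to place the centres so that every progression
    of m points with unit step meets a ball ([exists_hitting_packing]).

    Centres are taken on a grid of mesh 1 / (100 n) and periodically, so that
    they live in a finite torus.  The graph joining grid points that are too
    close to both be centres has fewer than b neighbours at each vertex, b
    being the number of grid points in a ball of radius 1.9.  Activate every
    grid point independently with probability 1 / (2 b) and keep the active
    points without active neighbour: a given point is kept with probability at
    least 1 / (4 b) ([card_isolated]).  The a grid points within 0.39 of a
    point of the progression are pairwise adjacent, so the events that they
    are kept are disjoint, and one of them is kept with probability at least
    a / (4 b).  Dividing by 5 in the grid shows b <= 5 ^ n * a
    ([card_torus_ball]), since 1.9 / 5 = 0.38 and the rounding error is at most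
    0.01; hence this probability is at least 1 / (4 * 5 ^ n).  Points of the
    progression that are at least 6 apart depend on disjoint sets of grid
    points, also on the torus if its side exceeds the length of the
    progression by 6 ([torus_separated]).  Thus the progression is missed
    with probability at most (1 - 1 / (4 * 5 ^ n)) ^ (m / 6)
    ([card_avoid]).

    After rounding the starting point and the direction ([approx_line]), only
    2 ^ O(n ^ 2) progressions have to be considered ([card_params]), so
    m = 1536 n ^ 2 5 ^ n points suffice for a union bound
    ([exists_indep_set]).  The polynomial factor is absorbed by
    eps_n = 5 (exp (28 / sqrt n) - 1).

    Probabilities are written as cardinals: a random activation is a function
    into 'I_q, and a vertex is active when its value is 0. *)

Local Open Scope nat_scope.

(** * Independent sets hitting families of cliques *)

Definition splice (V : finType) (W : Type) (D : {set V}) (f g : {ffun V -> W}) : {ffun V -> W} :=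
  [ffun v => if v \in D then g v else f v].

(** Independence of events that depend on disjoint sets of coordinates:
    exchanging the coordinates in [D] between the two components of a pair is
    an involution that maps A x E onto (A :&: E) x Omega. *)
Lemma card_indep (V W : finType) (D : {set V}) (A E : {set {ffun V -> W}}) :
  (forall f g : {ffun V -> W}, {in ~: D, f =1 g} -> (f \in A) = (g \in A)) ->
  (forall f g : {ffun V -> W}, {in D, f =1 g} -> (f \in E) = (g \in E)) ->
  #|A :&: E| * #|{ffun V -> W}| = #|A| * #|E|.
Proof.
move=> hA hE.
pose swap (p : {ffun V -> W} * {ffun V -> W}) :=
  (splice D p.1 p.2, splice D p.2 p.1).
have swapK : involutive swap.
  move=> [f g]; rewrite /swap /=; congr pair; apply/ffunP=> v;
  by rewrite !ffunE; case: (v \in D).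
have -> : #|{ffun V -> W}| = #|[set: {ffun V -> W}]| by rewrite cardsT.
rewrite -!cardsX -(card_preimset (finset.setX A E) (inv_inj swapK)).
apply: eq_card => -[f g]; rewrite !inE /= andbT.
congr andb.
- by apply: hA => v; rewrite !inE ffunE => /negbTE ->.
- by apply: hE => v vD; rewrite ffunE vD.
Qed.

Definition isolated (V : finType) (e : rel V) (q : nat) (f : {ffun V -> 'I_q}) : {set V} :=
  [set v | (f v == 0 :> nat) && [forall u, e v u ==> (f u != 0 :> nat)]].

(** Bernoulli's inequality (1 - 1/q) ^ d >= 1 - d/q, cleared of
    denominators. *)
Lemma bernoulli_sub (q d : nat) : 0 < q -> q ^ d * (q - d) <= (q - 1) ^ d * q.
Proof.
move=> q0; elim: d => [|d IH]; first by rewrite !expn0 subn0.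
rewrite !expnS.
have [qd|dq] := leqP q d.+1.
  have -> : q - d.+1 = 0 by lia.
  by rewrite muln0.
apply: leq_trans (_ : (q-1) * (q ^ d * (q - d)) <= _); last by rewrite -mulnA leq_mul2l IH orbT.
rewrite [leqLHS](_ : _ = q ^ d * (q * (q - d.+1))); last by ring.
rewrite [leqRHS](_ : _ = q ^ d * ((q-1) * (q - d))); last by ring.
by rewrite leq_mul2l; apply/orP; right; nia.
Qed.

(** A vertex is active with probability 1 / (2 b), and by Bernoulli's inequality
    its fewer than b neighbours are then all inactive with probability at least
    1/2. *)
Lemma card_isolated (V : finType) (e : rel V) (b : nat) (v : V) :
  irreflexive e -> #|[set u | e v u]| < b ->
  #|{ffun V -> 'I_(2 * b)}| <= 4 * b * #|[set f : {ffun V -> 'I_(2 * b)} | v \in isolated e f]|.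
Proof.
move=> eirr db; set q := 2 * b; set d := #|[set u | e v u]| in db.
have q0 : 0 < q by lia.
pose zero := [set c : 'I_q | c == 0 :> nat].
pose F u := if u == v then zero else if e v u then ~: zero else finset.setT.
have c0 : #|zero| = 1.
  by rewrite -(card1 (Ordinal q0)); apply: eq_card => c; rewrite !inE -val_eqE.
have c1 : #|~: zero| = q - 1.
  by have := cardsC zero; rewrite c0 card_ord; lia.
have -> : #|[set f : {ffun V -> 'I_q} | v \in isolated e f]| = #|family F|.
  apply: eq_card => f; rewrite !inE.
  apply/andP/familyP => [[fv0 /forallP fN] u | fF].
  - rewrite /F; case: eqP => [->|_]; first by rewrite inE.
    case: ifP => [evu|_]; last by rewrite inE.
    by rewrite !inE; move: (fN u); rewrite evu.
  - split; first by have := fF v; rewrite /F eqxx inE.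
    apply/forallP=> u; apply/implyP=> evu; have := fF u; rewrite /F evu.
    by case: eqP => [uv|_]; [rewrite uv eirr in evu | rewrite !inE].
rewrite card_family card_ffun card_ord.
rewrite foldrE big_map big_enum /=.
have -> : \prod_(u : V) #|F u| = (q - 1) ^ d * q ^ (#|V| - 1 - d).
  rewrite (bigD1 v) //= {1}/F eqxx c0 mul1n (bigID (e v)) /=.
  congr muln.
  - rewrite (eq_bigr (fun=> q - 1)); last first.
      by move=> u /andP [/negbTE uv evu]; rewrite /F uv evu c1.
    rewrite prod_nat_const; congr (_ ^ _); apply: eq_card => u.
    rewrite !inE unfold_in /=; by have [->|] := eqVneq u v; rewrite ?eirr.
  - rewrite (eq_bigr (fun=> q)); last first.
      by move=> u /andP [/negbTE uv /negbTE evu]; rewrite /F uv evu cardsT card_ord.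
    rewrite prod_nat_const; congr (_ ^ _).
    have <- : #|~: (v |: [set u | e v u])| = #|V| - 1 - d.
      have := cardsC (v |: [set u | e v u]); rewrite cardsU1 inE eirr /= -/d; lia.
    by apply: eq_card => u; rewrite !inE unfold_in negb_or.
have dV : d.+1 <= #|V|.
  by have := max_card (mem (v |: [set u | e v u])); rewrite cardsU1 inE eirr.
rewrite [X in q ^ X](_ : #|V| = d + (#|V| - 1 - d) + 1); last by lia.
rewrite !expnD expn1.
have := bernoulli_sub d q0.
set y := q ^ (_ - _); set x := q ^ d; set z := (_ ^ d) => h.
have h2 : x * b <= z * q by apply: leq_trans h; rewrite leq_mul2l; apply/orP; right; lia.
rewrite [leqLHS](_ : _ = 2 * y * (x * b)); last by rewrite /q; ring.
rewrite [leqRHS](_ : _ = 2 * y * (z * q)); last by rewrite /q; ring.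
by rewrite leq_mul2l h2 orbT.
Qed.

Lemma isolated_indep (V : finType) (e : rel V) (q : nat) (f : {ffun V -> 'I_q}) u v :
  u \in isolated e f -> v \in isolated e f -> ~~ e u v.
Proof.
rewrite !inE => /andP [_ /forallP /(_ v) h] /andP [fv _].
by apply/negP => euv; move: h; rewrite euv fv.
Qed.

Lemma isolated_local (V : finType) (e : rel V) (q : nat) (f g : {ffun V -> 'I_q}) v :
  (forall w, (w == v) || e v w -> f w = g w) ->
  (v \in isolated e f) = (v \in isolated e g).
Proof.
move=> fg; rewrite !inE (fg v) ?eqxx //; congr andb.
apply: eq_forallb => u; case evu: (e v u) => //=; by rewrite fg // evu orbT.
Qed.

Definition hit (V : finType) (e : rel V) (q : nat) (C : {set V}) : {set {ffun V -> 'I_q}} :=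
  [set f | [exists v in C, v \in isolated e f]].

(** At most one vertex of a clique is isolated, so the probabilities given by
    [card_isolated] add up over [C]. *)
Lemma card_hit (V : finType) (e : rel V) (a b : nat) (C : {set V}) :
  irreflexive e -> (forall v, #|[set u | e v u]| < b) ->
  {in C &, forall u v, u != v -> e u v} -> a <= #|C| ->
  a * #|{ffun V -> 'I_(2 * b)}| <= 4 * b * #|hit e (2 * b) C|.
Proof.
move=> eirr db clq aC.
apply: (@leq_trans (\sum_(v in C) #|{ffun V -> 'I_(2 * b)}|)).
  by rewrite sum_nat_const leq_mul2r aC orbT.
apply: leq_trans (_ : 4 * b * \sum_(v in C)
    #|[set f : {ffun V -> 'I_(2 * b)} | v \in isolated e f]| <= _).
  by rewrite big_distrr /=; apply: leq_sum => v _; apply: card_isolated.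
rewrite leq_mul2l; apply/orP; right.
under eq_bigr => v _ do rewrite -sum1dep_card big_mkcond /=.
rewrite exchange_big /= -sum1_card [leqRHS]big_mkcond /=.
apply: leq_sum => f _; rewrite inE.
case: existsP => [[v /andP [vC vf]]|nf].
  rewrite (bigD1 v) //= vf big1 // => w /andP [wC wv].
  case: ifP => // wf; have := isolated_indep wf vf.
  by rewrite clq.
rewrite big1 // => v vC; case: ifP => // vf; case: nf.
by exists v; rewrite vC.
Qed.

(** The closed neighbourhoods of the cliques being disjoint, the events of
    hitting them are independent; each clique multiplies the probability of
    having missed all of them by at most 1 - a / (4 b). *)
Lemma card_avoid (V : finType) (e : rel V) (a b J : nat) (C : nat -> {set V}) :
  irreflexive e -> 0 < b -> (forall v, #|[set u | e v u]| < b) ->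
  (forall j, j < J -> {in C j &, forall u v, u != v -> e u v}) ->
  (forall j, j < J -> a <= #|C j|) ->
  (forall i j u v w, i < j < J -> u \in C i -> v \in C j ->
     (w == u) || e u w -> (w == v) || e v w -> False) ->
  (4 * b) ^ J * #|[set f | [forall j : 'I_J, f \notin hit e (2 * b) (C j)]]| <=
    (4 * b - a) ^ J * #|{ffun V -> 'I_(2 * b)}|.
Proof.
move=> eirr b0 db; elim: J => [|J IH] clq aC dis.
  by rewrite !expn0 !mul1n max_card.
have {}IH : (4 * b) ^ J * #|[set f | [forall j : 'I_J, f \notin hit e (2 * b) (C j)]]| <=
    (4 * b - a) ^ J * #|{ffun V -> 'I_(2 * b)}|.
  apply: IH => [j jJ|j jJ|i j u v w /andP [ij jJ]].
  - by apply: clq; apply: ltnW.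
  - by apply: aC; apply: ltnW.
  - by apply: dis; rewrite ij ltnW.
set A := [set f | _] in IH; set E := hit e (2 * b) (C J).
have -> : [set f | [forall j : 'I_J.+1, f \notin hit e (2 * b) (C j)]] = A :\: E.
  apply/setP => f; rewrite !inE; apply/forallP/andP => [h|[fE /forallP h] j].
  - split; first by have := h ord_max; rewrite !inE.
    by apply/forallP => j; apply: (h (widen_ord (leqnSn J) j)).
  - case: (ltngtP j J) => [jJ|jJ|->]; last by rewrite inE.
    + exact: (h (Ordinal jJ)).
    + by have := ltn_ord j; rewrite ltnS leqNgt jJ.
(* the event of hitting C J depends only on the coordinates in D *)
pose D := [set w | [exists v in C J, (w == v) || e v w]].
have ind : #|A :&: E| * #|{ffun V -> 'I_(2 * b)}| = #|A| * #|E|.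
  apply: (card_indep (D := D)) => f g fg.
  - rewrite !inE; apply: eq_forallb => j; congr negb; rewrite !inE.
    apply: eq_existsb => u; case uC: (u \in C j) => //=.
    apply: isolated_local => w wu; apply: fg; rewrite !inE.
    apply/existsP => -[v /andP [vC wv]].
    by apply: (dis j J u v w) => //; rewrite ltn_ord /=.
  - rewrite !inE; apply: eq_existsb => u; case uC: (u \in C J) => //=.
    apply: isolated_local => w wu; apply: fg; rewrite !inE.
    by apply/existsP; exists u; rewrite uC.
have hJ := card_hit eirr db (clq J (leqnn _)) (aC J (leqnn _)).
rewrite -/E in hJ.
set W := #|{ffun V -> 'I_(2 * b)}| in ind hJ IH *.
have W0 : 0 < W by rewrite /W card_ffun card_ord expn_gt0; lia.
have key : a * #|A| <= 4 * b * #|A :&: E|.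
  rewrite -(leq_pmul2r W0) -[leqRHS]mulnA ind.
  rewrite [leqLHS](_ : _ = #|A| * (a * W)); last by ring.
  rewrite [leqRHS](_ : _ = #|A| * (4 * b * #|E|)); last by ring.
  by rewrite leq_mul2l hJ orbT.
have step : 4 * b * #|A :\: E| <= (4 * b - a) * #|A|.
  by rewrite cardsD mulnBr mulnBl leq_sub2l.
rewrite !expnSr -mulnA; apply: leq_trans (_ : (4 * b) ^ J * ((4 * b - a) * #|A|) <= _).
  by rewrite leq_mul2l step orbT.
rewrite [leqLHS](_ : _ = (4 * b - a) * ((4 * b) ^ J * #|A|)); last by ring.
by rewrite [leqRHS](_ : _ = (4 * b - a) * ((4 * b - a) ^ J * W)); [rewrite leq_mul2l IH orbT|ring].
Qed.

(** Union bound over the families of cliques [C t], for the isolated vertices of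
    a random activation. *)
Lemma exists_indep_set (V T : finType) (P : pred T) (e : rel V) (a b J : nat)
    (C : T -> nat -> {set V}) :
  irreflexive e -> 0 < b -> (forall v, #|[set u | e v u]| < b) ->
  (forall t j, P t -> j < J -> {in C t j &, forall u v, u != v -> e u v}) ->
  (forall t j, P t -> j < J -> a <= #|C t j|) ->
  (forall t i j u v w, P t -> i < j < J -> u \in C t i -> v \in C t j ->
     (w == u) || e u w -> (w == v) || e v w -> False) ->
  #|T| * (4 * b - a) ^ J < (4 * b) ^ J ->
  exists I : {set V}, {in I &, forall u v, ~~ e u v} /\
    (forall t, P t -> exists2 j, j < J & exists2 v, v \in C t j & v \in I).
Proof.
move=> eirr b0 db clq aC dis cardT.
pose bad t := [set f | [forall j : 'I_J, f \notin hit e (2 * b) (C t j)]].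
have badW t : P t -> (4 * b) ^ J * #|bad t| <= (4 * b - a) ^ J * #|{ffun V -> 'I_(2 * b)}|.
  move=> Pt; apply: card_avoid => // [j|j|i j u v w]; [exact: clq|exact: aC|exact: dis].
set W := #|{ffun V -> 'I_(2 * b)}| in badW *.
have W0 : 0 < W by rewrite /W card_ffun card_ord expn_gt0; lia.
have [f fgood] : exists f, ~~ [exists t, P t && (f \in bad t)].
  apply/existsP; rewrite -[X in is_true X]negbK negb_exists; apply/negP => /forallP h.
  have cover : W <= \sum_(t | P t) #|bad t|.
    under eq_bigr => t _ do rewrite -sum1_card big_mkcond /=.
    rewrite exchange_big /= /W -sum1_card; apply: leq_sum => f _.
    have := h f; rewrite negbK => /existsP [t /andP [Pt fb]].
    by rewrite (bigD1 t) //= fb.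
  have : (4 * b) ^ J * W <= #|T| * (4 * b - a) ^ J * W.
    apply: leq_trans (_ : (4 * b) ^ J * \sum_(t | P t) #|bad t| <= _).
      by rewrite leq_mul2l cover orbT.
    rewrite big_distrr /=.
    apply: (@leq_trans (\sum_(t | P t) (4 * b - a) ^ J * W)); first exact: leq_sum.
    by rewrite sum_nat_const -mulnA leq_mul2r max_card orbT.
  by rewrite leq_mul2r leqNgt cardT orbF; apply/negP; rewrite -lt0n.
exists (isolated e f); split; first by move=> u v; exact: isolated_indep.
move=> t Pt; have : f \notin bad t.
  by apply: contra fgood => fb; apply/existsP; exists t; rewrite Pt.
rewrite inE negb_forall => /existsP [j]; rewrite negbK inE => /existsP [v /andP [vC vf]].
by exists j => //; exists v.
Qed.

(** * Counting estimates *)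

(** The content is that (1 - a / c) ^ h <= 1/2 as soon as
    a / c >= 1 / h, which follows from Bernoulli's inequality for
    (c / (c - a)) ^ h. *)
Lemma pow_decay (c a h L : nat) : (0 < h -> c <= h * a ->
  (c - a) ^ (h * L) * 2 ^ L <= c ^ (h * L))%N.
Proof.
move=> h0 cha; rewrite !expnM -expnMn.
case: L => [|L]; first by rewrite !expn0.
rewrite leq_exp2r //.
have [ca|ac] := leqP c a.
  by move: ca; rewrite -subn_eq0 => /eqP ->; rewrite exp0n.
set x := (c - a)%N; have x0 : (0 < x)%N by rewrite subn_gt0.
have bern k : (x ^ k * (x + k * a) <= (x + a) ^ k * x)%N.
  elim: k => [|k IH]; first by rewrite !expn0 mul0n addn0.
  rewrite !expnS.
  apply: (@leq_trans ((x + a) * (x ^ k * (x + k * a)))).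
    rewrite [leqLHS](_ : _ = x ^ k * (x * (x + k.+1 * a)))%N; last by ring.
    rewrite [leqRHS](_ : _ = x ^ k * ((x + a) * (x + k * a)))%N; last by ring.
    by rewrite leq_mul2l; apply/orP; right; nia.
  by rewrite -mulnA leq_mul2l IH orbT.
have xc : (x + a = c)%N by rewrite subnK // ltnW.
have {bern} := bern h; rewrite xc => bern.
rewrite -(leq_pmul2r x0); apply: leq_trans bern.
by rewrite -mulnA leq_mul2l; apply/orP; right; lia.
Qed.

(** [K ^ n] counts the starting points and [(2 * (100 * n * m) + 1) ^ n] the
    directions of the rounded progressions; the bound [2 ^ (64 * n ^ 2)] is
    what [64 * n ^ 2] halvings of the failure probability compensate. *)
Lemma card_params (n m K : nat) : (0 < n -> m = 1536 * n ^ 2 * 5 ^ n ->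
  K = 100 * n * (m + 6) -> K ^ n * (2 * (100 * n * m) + 1) ^ n < 2 ^ (64 * n ^ 2))%N.
Proof.
move=> n0 mE KE.
have n3 : (n ^ 3 <= 2 ^ (3 * n))%N.
  by rewrite mulnC expnM leq_exp2r // ltnW // ltn_expl.
have f3 : (5 ^ n <= 2 ^ (3 * n))%N by rewrite expnM leq_exp2r.
have m6 : (m + 6 <= 1542 * (n ^ 2 * 5 ^ n))%N.
  have : (0 < n ^ 2 * 5 ^ n)%N by rewrite muln_gt0 !expn_gt0 n0.
  rewrite mE; lia.
have KB : (K <= 2 ^ (18 + 6 * n))%N.
  rewrite KE; apply: (@leq_trans (154200 * (n ^ 3 * 5 ^ n))).
    have -> : (154200 * (n ^ 3 * 5 ^ n) = 100 * n * (1542 * (n ^ 2 * 5 ^ n)))%N by ring.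
    by rewrite leq_mul2l m6 orbT.
  rewrite expnD; apply: leq_mul.
    by have -> : (2 ^ 18 = 512 * 512)%N by rewrite (expnD 2 9 9); lia.
  have -> : (6 * n = 3 * n + 3 * n)%N by lia.
  by rewrite expnD; apply: leq_mul.
have MB : (2 * (100 * n * m) + 1 <= 2 ^ (19 + 6 * n))%N.
  rewrite addSn expnS; apply: (@leq_trans (2 * K)); last by rewrite leq_mul2l KB.
  by rewrite KE mulnDr; lia.
rewrite -expnMn; apply: (@leq_ltn_trans ((2 ^ (37 + 12 * n)) ^ n)).
  rewrite leq_exp2r //; apply: leq_trans (leq_mul KB MB) _.
  by rewrite -expnD leq_exp2l //; lia.
by rewrite -expnM ltn_exp2l //; nia.
Qed.

Local Open Scope ring_scope.

(** * Euclidean norm *)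

Lemma enorm_ge0 (R : realType) n (x : 'rV[R]_n) : 0 <= enorm x.
Proof. exact: sqrtr_ge0. Qed.

Lemma sqr_enorm (R : realType) n (x : 'rV[R]_n) : enorm x ^+ 2 = \sum_(i < n) x 0 i ^+ 2.
Proof. by rewrite sqr_sqrtr // sumr_ge0 // => i _; apply: sqr_ge0. Qed.

Lemma enormZ (R : realType) n (c : R) (x : 'rV[R]_n) : enorm (c *: x) = `|c| * enorm x.
Proof.
rewrite /enorm -sqrtr_sqr -sqrtrM ?sqr_ge0 // mulr_sumr; congr Num.sqrt.
by apply: eq_bigr => i _; rewrite mxE exprMn.
Qed.

Lemma enormN (R : realType) n (x : 'rV[R]_n) : enorm (- x) = enorm x.
Proof. by rewrite -scaleN1r enormZ normrN1 mul1r. Qed.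

Lemma enormBC (R : realType) n (x y : 'rV[R]_n) : enorm (x - y) = enorm (y - x).
Proof. by rewrite -enormN opprB. Qed.

Lemma enorm0 (R : realType) n : enorm (0 : 'rV[R]_n) = 0.
Proof. by rewrite -(scale0r 0) enormZ normr0 mul0r. Qed.

Lemma enorm_eq0 (R : realType) n (x : 'rV[R]_n) : enorm x = 0 -> x = 0.
Proof.
move=> x0; have /eqP := sqr_enorm x.
rewrite x0 expr0n eq_sym psumr_eq0 => [/allP h|i _]; last exact: sqr_ge0.
apply/rowP => i; rewrite mxE; apply/eqP; rewrite -sqrf_eq0.
by apply: h; rewrite mem_index_enum.
Qed.

Lemma enorm_coord (R : realType) n (x : 'rV[R]_n) i : `|x 0 i| <= enorm x.
Proof.
rewrite -sqrtr_sqr ler_wsqrtr // (bigD1 i) //= lerDl.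
by apply: sumr_ge0 => j _; exact: sqr_ge0.
Qed.

Lemma enorm_box (R : realType) n (c : R) (x : 'rV[R]_n) :
  (forall i, `|x 0 i| <= c) -> enorm x <= c * n%:R.
Proof.
case: n x => [|n] x xc; first by rewrite /enorm big_ord0 sqrtr0 mulr0.
have c0 : 0 <= c by apply: le_trans (xc ord0).
rewrite -[leRHS]ger0_norm ?mulr_ge0 // -sqrtr_sqr ler_wsqrtr //.
apply: le_trans (_ : \sum_(i < n.+1) c ^+ 2 <= _).
  by apply: ler_sum => i _; rewrite -[leLHS]real_normK ?num_real // lerXn2r ?nnegrE.
rewrite sumr_const card_ord -[leLHS]mulr_natr exprMn; apply: ler_wpM2l; first exact: sqr_ge0.
by rewrite -natrX ler_nat expnS expn1 leq_pmulr.
Qed.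

(** The Cauchy-Schwarz inequality comes from expanding the sum of
    (|y| x_i - |x| y_i) ^ 2. *)
Lemma enormD (R : realType) n (x y : 'rV[R]_n) : enorm (x + y) <= enorm x + enorm y.
Proof.
have [/eqP/enorm_eq0 ->|x0] := boolP (enorm x == 0); first by rewrite add0r enorm0 add0r.
have [/eqP/enorm_eq0 ->|y0] := boolP (enorm y == 0); first by rewrite addr0 enorm0 addr0.
have {}x0 : 0 < enorm x by rewrite lt_def x0 enorm_ge0.
have {}y0 : 0 < enorm y by rewrite lt_def y0 enorm_ge0.
rewrite -ler_sqr ?nnegrE ?addr_ge0 ?enorm_ge0 // sqr_enorm.
have -> : \sum_i (x + y) 0 i ^+ 2 = enorm x ^+ 2 + enorm y ^+ 2 + 2 * \sum_i x 0 i * y 0 i.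
  by rewrite !sqr_enorm mulr_sumr -!big_split /=; apply: eq_bigr => i _; rewrite mxE; ring.
suff cs : \sum_i x 0 i * y 0 i <= enorm x * enorm y by nra.
have : 0 <= \sum_i (enorm y * x 0 i - enorm x * y 0 i) ^+ 2.
  by apply: sumr_ge0 => i _; exact: sqr_ge0.
have -> : \sum_i (enorm y * x 0 i - enorm x * y 0 i) ^+ 2 =
    (enorm x * enorm y) * (2 * (enorm x * enorm y - \sum_i x 0 i * y 0 i)).
  rewrite [RHS](_ : _ = enorm y ^+ 2 * enorm x ^+ 2 + enorm x ^+ 2 * enorm y ^+ 2
     + (- 2 * enorm x * enorm y) * \sum_i x 0 i * y 0 i); last by ring.
  move: (sqr_enorm x) (sqr_enorm y).
  move: (enorm x) (enorm y) => a b xa yb.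
  rewrite [in X in X + _ + _]xa [in X in _ + X + _]yb !mulr_sumr -!big_split /=.
  by apply: eq_bigr => i _; ring.
by rewrite pmulr_rge0 ?mulr_gt0 // pmulr_rge0 // subr_ge0.
Qed.

(** * Lattice points on a torus *)

(** With [S := R] this is the inclusion of the integer lattice in Euclidean space,
    with [S := 'Z_K] the reduction to the torus of side [K]. *)
Definition intvec (S : nzRingType) n (z : 'rV[int]_n) : 'rV[S]_n := map_mx intr z.

Lemma intvecD (S : nzRingType) n (z w : 'rV[int]_n) : intvec S (z + w) = intvec S z + intvec S w.
Proof. exact: raddfD. Qed.

Lemma intvecB (S : nzRingType) n (z w : 'rV[int]_n) : intvec S (z - w) = intvec S z - intvec S w.
Proof. exact: raddfB. Qed.

Lemma intvec0 (S : nzRingType) n : intvec S (0 : 'rV[int]_n) = 0.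
Proof. exact: raddf0. Qed.

Lemma dvdn_absz_Zp K (z : int) : (1 < K)%N -> z%:~R = 0 :> 'Z_K -> (K %| `|z|)%N.
Proof.
move=> K1 z0; have : (`|z|%N%:R : 'Z_K) = 0.
  by case: (intP z) z0 => [|m|m]; rewrite ?mulrNz ?abszN //= => /eqP; rewrite ?oppr_eq0 => /eqP.
by move/(congr1 val); rewrite /= val_Zp_nat // => /eqP.
Qed.

(** The nonzero vectors of the period lattice have length at least [K]. *)
Lemma torus_inj (R : realType) K n (z w : 'rV[int]_n) :
  (1 < K)%N -> intvec 'Z_K z = intvec 'Z_K w ->
  enorm (intvec R (z - w)) < K%:R -> z = w.
Proof.
move=> K1 /eqP; rewrite -subr_eq0 -intvecB => /eqP zw0 zwK.
apply/eqP; rewrite -subr_eq0; apply/eqP/rowP => i; rewrite mxE.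
have := congr1 (fun v : 'rV['Z_K]_n => v 0 i) zw0; rewrite !mxE => /(dvdn_absz_Zp K1) dvd.
have := le_lt_trans (enorm_coord _ i) zwK; rewrite !mxE.
set d := z 0 i + _ in dvd *.
rewrite -intr_norm -natr_absz ltr_nat ltnNge => /negP h; apply/eqP; rewrite -absz_eq0.
by apply/contraT; rewrite -lt0n => /dvdn_leq/(_ dvd).
Qed.

Definition torus_ball (R : realType) K n (r : R) : {set 'rV['Z_K]_n} :=
  [set g | `[< exists2 z, intvec 'Z_K z = g & enorm (intvec R z) <= r >]].

Lemma torus_ballP (R : realType) K n (r : R) (g : 'rV['Z_K]_n) :
  reflect (exists2 z, intvec 'Z_K z = g & enorm (intvec R z) <= r) (g \in torus_ball K n r).
Proof. by rewrite inE; apply: asboolP. Qed.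

(** Euclidean division by 5 of the coordinates maps the ball of radius [5 * r]
    into the ball of radius [r + n], and a point is determined by its quotient
    and one of 5 ^ n remainders.  The bound on [K] makes the quotients
    recoverable from their images in the torus. *)
Lemma card_torus_ball (R : realType) K n (r : R) :
  (1 < K)%N -> 2 * (r + n%:R) < K%:R ->
  (#|torus_ball K n (5 * r)| <= 5 ^ n * #|torus_ball K n (r + n%:R)|)%N.
Proof.
move=> K1 rK.
pose lift (g : 'rV['Z_K]_n) := xget 0 [set z | intvec 'Z_K z = g /\ enorm (intvec R z) <= 5 * r]%classic.
have liftP g : g \in torus_ball K n (5 * r) ->
    intvec 'Z_K (lift g) = g /\ enorm (intvec R (lift g)) <= 5 * r.
  move=> /torus_ballP [z zg zr]; rewrite /lift; case: xgetP => [y _ //|/(_ z)].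
  by case.
pose quo (z : 'rV[int]_n) : 'rV[int]_n := map_mx (fun a => (a %/ 5)%Z) z.
pose rem (z : 'rV[int]_n) : {ffun 'I_n -> 'I_5} := [ffun i => inord (absz (modz (z 0 i) 5))].
have rem5 (a : int) : (`|(a %% 5)%Z| < 5)%N by lia.
have quo_ball z : enorm (intvec R z) <= 5 * r -> enorm (intvec R (quo z)) <= r + n%:R.
  move=> zr; have -> : intvec R (quo z) = 5^-1 *: intvec R z + (intvec R (quo z) - 5^-1 *: intvec R z).
    by rewrite addrC subrK.
  apply: le_trans (enormD _ _) _; apply: lerD.
    by rewrite enormZ ger0_norm ?invr_ge0 // mulrC ler_pdivrMr // mulrC.
  rewrite -[leRHS]mul1r; apply: enorm_box => i; rewrite !mxE.
  have := divz_eq (z 0 i) 5 => /(congr1 (fun a : int => a%:~R : R)).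
  rewrite intrD intrM => ->.
  have m0 : 0 <= (modz (z 0 i) 5)%:~R :> R by rewrite ler0z; lia.
  have m5 : (modz (z 0 i) 5)%:~R <= 5 :> R by rewrite (ler_int _ _ 5); lia.
  by rewrite ler_norml; apply/andP; split; lra.
pose code g := (rem (lift g), intvec 'Z_K (quo (lift g))).
have code_inj : {in torus_ball K n (5 * r) &, injective code}.
  move=> g h /liftP [gl gr] /liftP [hl hr] [remE quoE].
  rewrite -gl -hl; congr intvec.
  have {}quoE : quo (lift g) = quo (lift h).
    apply: (torus_inj (R := R) K1 quoE); rewrite intvecB.
    apply: le_lt_trans (enormD _ _) _; rewrite enormN.
    apply: le_lt_trans rK; rewrite mulr2n mulrDl mul1r.
    by apply: lerD; apply: quo_ball.
  apply/rowP => i; rewrite (divz_eq (lift g 0 i) 5) (divz_eq (lift h 0 i) 5).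
  have := congr1 (fun v : 'rV[int]_n => v 0 i) quoE; rewrite !mxE => ->.
  have := congr1 (fun f : {ffun 'I_n -> 'I_5} => val (f i)) remE.
  rewrite !ffunE /= !inordK //; lia.
rewrite -(card_in_imset code_inj).
apply: (@leq_trans #|finset.setX [set: {ffun 'I_n -> 'I_5}] (torus_ball K n (r + n%:R))|).
  apply: subset_leq_card; apply/fintype.subsetP => _ /imsetP [g /liftP [gl gr] ->].
  rewrite finset.in_setX finset.in_setT /=; apply/torus_ballP.
  by exists (quo (lift g)) => //; apply: quo_ball.
by rewrite cardsX cardsT card_ffun !card_ord.
Qed.

(** If the two perturbed lattice points agree on the torus they agree in the
    lattice by [torus_inj], which puts [p] and [p'] within 2 d + 2 r of each
    other. *)
Lemma torus_separated (R : realType) K n (d r : R) (p p' : 'rV[R]_n) (w w' q q' : 'rV[int]_n) :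
  (1 < K)%N ->
  enorm (intvec R w - p) <= d -> enorm (intvec R w' - p') <= d ->
  enorm (intvec R q) <= r -> enorm (intvec R q') <= r ->
  intvec 'Z_K (w + q) = intvec 'Z_K (w' + q') ->
  2 * d + 2 * r < enorm (p - p') -> enorm (p - p') + 2 * d + 2 * r < K%:R -> False.
Proof.
move=> K1 wp wp' qr qr' eqT low high.
pose g := (intvec R w - p) - (intvec R w' - p') + (intvec R q - intvec R q').
have gle : enorm g <= 2 * d + 2 * r.
  have := enormD ((intvec R w - p) - (intvec R w' - p')) (intvec R q - intvec R q').
  have := enormD (intvec R w - p) (- (intvec R w' - p')).
  have := enormD (intvec R q) (- intvec R q').
  by rewrite !enormN -/g; lra.
have gE : intvec R ((w + q) - (w' + q')) = (p - p') + g.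
  by rewrite intvecB !intvecD /g; apply/rowP => l; rewrite !mxE; ring.
have : w + q = w' + q'.
  apply: (torus_inj (R := R) K1 eqT); rewrite gE.
  by apply: le_lt_trans (enormD _ _) _; lra.
move=> /eqP; rewrite -subr_eq0 => /eqP eq0.
move: gE; rewrite eq0 intvec0 => /esym/eqP; rewrite addr_eq0 => /eqP pE.
by move: low; rewrite pE enormN ltNge gle.
Qed.

(** * A periodic packing hitting every long progression *)

(** The displacement after 6 j steps along a rounded direction: [U] codes the
    direction (U - M) / M, the shift by [M] making its entries natural
    numbers, and M / m is the number of grid points per unit of length. *)
Definition displacement (R : realType) n (M m : nat) (U : 'I_n -> nat) (j : nat) : 'rV[int]_n :=
  \row_i Num.floor ((6 * j)%:R / m%:R * ((U i)%:R - M%:R) : R).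

(** Each coordinate is off by less than 3: rounding the starting point costs at
    most 1, rounding the direction at most 6 j / m <= 1, and rounding the
    displacement at most 1. *)
Lemma approx_line (R : realType) n (k m : nat) (x u : 'rV[R]_n) :
  (0 < m)%N -> enorm u = 1 ->
  exists (X : 'rV[int]_n) (U : 'I_n -> 'I_((2 * (k * m)).+1)), forall j, (6 * j <= m)%N ->
    enorm (intvec R (X + displacement R (k * m) m U j) - k%:R *: (x + (6 * j)%:R *: u)) <= (3 * n)%:R.
Proof.
move=> m0 u1; set M := (k * m)%N.
have mR : 0 < m%:R :> R by rewrite ltr0n.
pose V i : int := Num.floor (M%:R * u 0 i).
have ui i : - 1 <= u 0 i <= 1 by rewrite -ler_norml -u1; exact: enorm_coord.
have V1 i : - M%:Z <= V i.
  rewrite floor_ge_int rmorphN /=; have := ui i => /andP [? _].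
  by rewrite -mulrN1 ler_wpM2l.
have V2 i : V i <= M%:Z.
  rewrite -(ler_int R); apply: le_trans (floor_le _) _; have := ui i => /andP [_ ?].
  by rewrite -[leRHS]mulr1 ler_wpM2l.
pose U i : 'I_((2 * M).+1) := inord (absz (V i + M%:Z)).
have UE i : (U i)%:R - M%:R = (V i)%:~R :> R.
  have -> : (U i : nat) = absz (V i + M%:Z).
    by rewrite /U inordK //; have := V1 i; have := V2 i; lia.
  rewrite natr_absz ger0_norm; last by have := V1 i; lia.
  by rewrite intrD addrK.
exists (\row_i Num.floor (k%:R * x 0 i)), U => j jm.
rewrite (natrM _ 3 n); apply: enorm_box => i; rewrite !mxE UE intrD.
have t0 : 0 <= (6 * j)%:R / m%:R :> R by rewrite divr_ge0.
have t1 : (6 * j)%:R / m%:R <= 1 :> R by rewrite ler_pdivrMr // mul1r ler_nat.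
have tE : k%:R * ((6 * j)%:R * u 0 i) = (6 * j)%:R / m%:R * (M%:R * u 0 i).
  by rewrite /M natrM; field; rewrite gt_eqF.
rewrite mulrDr tE; set t := (_ / _) in t0 t1 *.
have /andP [a1 a2] := floor_itv (k%:R * x 0 i).
have /andP [b1 b2] := floor_itv (t * (V i)%:~R).
have /andP [c1 c2] := floor_itv (M%:R * u 0 i).
rewrite -/(V i) !intrD in a2 b2 c1 c2.
have d1 : t * (V i)%:~R <= t * (M%:R * u 0 i) by rewrite ler_wpM2l.
have d2 : t * (M%:R * u 0 i) <= t * (V i)%:~R + t.
  by rewrite -[X in _ + X]mulr1 -mulrDr ler_wpM2l // ltW.
by rewrite ler_norml; apply/andP; split; lra.
Qed.

(** Lengths are in units of the mesh 1 / (100 n): the centres are more than 1.9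
    apart and one of them lies within 0.42 of the progression.  The latter is
    0.39, the radius of the cliques, plus 0.03 for the rounding in
    [approx_line].  Adjacency means distance at most 1.9 on the torus, and
    only every sixth point of the progression is used, to make the closed
    neighbourhoods of the cliques disjoint: 2 * (0.39 + 1.9 + 0.03) < 6. *)
Lemma exists_hitting_packing (R : realType) n : (0 < n)%N ->
  exists P : 'rV[int]_n -> Prop,
  (forall z w, P z -> P w -> z != w -> (190 * n)%:R < enorm (intvec R (z - w))) /\
  (forall x u : 'rV[R]_n, enorm u = 1 ->
     exists2 j, (j < 1536 * n ^ 2 * 5 ^ n)%N &
     exists2 z, P z & enorm (intvec R z - (100 * n)%:R *: (x + j%:R *: u)) <= (42 * n)%:R).
Proof.
move=> n0.
pose k := (100 * n)%N; pose L := (64 * n ^ 2)%N; pose J := (4 * 5 ^ n * L)%N.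
pose m := (6 * J)%N; pose K := (k * (m + 6))%N; pose M := (k * m)%N.
have mE : m = (1536 * n ^ 2 * 5 ^ n)%N by rewrite /m /J /L; ring.
have J0 : (0 < J)%N by rewrite /J /L !muln_gt0 !expn_gt0 n0.
have m0 : (0 < m)%N by rewrite /m muln_gt0.
have K1 : (1 < K)%N.
  by apply: (@leq_trans (m + 6)); [lia | rewrite leq_pmull // /k muln_gt0].
have nR : 1 <= n%:R :> R by rewrite ler1n.
have KR : K%:R = 100 * n%:R * (m%:R + 6) :> R 
  by rewrite /K /k (natrM _ (100 * n)) (natrM _ 100) (natrD _ m).
have mR : 0 <= m%:R :> R by [].
have K6 : 600 * n%:R <= K%:R :> R by rewrite KR; nra.
pose G := 'rV['Z_K]_n.
pose r : R := (190 * n)%:R; pose s : R := (39 * n)%:R.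
have rE : r = 190 * n%:R by rewrite /r natrM.
have sE : s = 39 * n%:R by rewrite /s natrM.
pose e : rel G := fun g h => (g != h) && (h - g \in torus_ball K n r).
pose T := (G * {ffun 'I_n -> 'I_((2 * M).+1)})%type.
pose Y (t : T) j : G := t.1 + intvec 'Z_K (displacement R M m (t.2 : 'I_n -> 'I_((2 * M).+1)) j).
(* t is a rounding of the progression that starts at x with direction u *)
pose follows (t : T) (x u : 'rV[R]_n) := forall j, (j < J)%N ->
  exists2 w, intvec 'Z_K w = Y t j &
    enorm (intvec R w - k%:R *: (x + (6 * j)%:R *: u)) <= (3 * n)%:R.
pose P (t : T) := `[< exists x u, enorm u = 1 /\ follows t x u >].
pose C (t : T) j : {set G} := [set g | g - Y t j \in torus_ball K n s].
pose b := #|torus_ball K n r|; pose a := #|torus_ball K n s|.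
have transl_card (B : {set G}) (y : G) : #|[set g : G | g - y \in B]| = #|B|.
  exact: (card_preimset B (addIr (- y))).
have zero_ball : (0 : G) \in torus_ball K n r.
  by apply/torus_ballP; exists 0; rewrite ?intvec0 ?enorm0.
have ba : (b <= 5 ^ n * a)%N.
  rewrite /b /a; have -> : r = 5 * (38 * n)%:R by rewrite rE natrM; ring.
  have -> : s = (38 * n)%:R + n%:R by rewrite sE natrM; ring.
  apply: card_torus_ball => //; rewrite (natrM _ 38 n); lra.
have nbhd v w : (w == v) || e v w ->
    exists2 c, intvec 'Z_K c = w - v & enorm (intvec R c) <= r.
  case/orP => [/eqP ->|/andP [_ /torus_ballP //]].
  by exists 0; rewrite ?subrr ?intvec0 ?enorm0.
have [I [Iindep Ihit]] : exists I : {set G}, {in I &, forall u v, ~~ e u v} /\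
    (forall t, P t -> exists2 j, (j < J)%N & exists2 v, v \in C t j & v \in I).
  apply: (@exists_indep_set _ _ P e a b J C).
  - by move=> g; rewrite /e eqxx.
  - by apply/card_gt0P; exists 0.
  - move=> v; rewrite /b -(transl_card (torus_ball K n r) v); apply: proper_card; apply/properP; split.
      apply/fintype.subsetP => g; rewrite finset.in_set => /andP [_ gv].
      by rewrite finset.in_set.
    by exists v; rewrite finset.in_set ?subrr // /e eqxx.
  - move=> t j _ _ u v; rewrite finset.in_set => /torus_ballP [z zu zs].
    rewrite finset.in_set => /torus_ballP [w wv ws] uv.
    rewrite /e uv /=; apply/torus_ballP; exists (w - z).
      by rewrite intvecB zu wv opprB addrA subrK.
    by rewrite intvecB; apply: le_trans (enormD _ _) _; rewrite enormN; lra.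
  - by move=> t j _ _; rewrite transl_card.
  - move=> t i j u v w Pt /andP [ij jJ] uC vC wu wv.
    have /asboolP [x [d [d1 fol]]] := Pt.
    have [wi wiE wix] := fol i (ltn_trans ij jJ).
    have [wj wjE wjx] := fol j jJ.
    move: uC vC; rewrite finset.in_set => /torus_ballP [zu zuE zur].
    rewrite finset.in_set => /torus_ballP [zv zvE zvr].
    have [cu cuE cur] := nbhd _ _ wu; have [cv cvE cvr] := nbhd _ _ wv.
    pose p l := k%:R *: (x + (6 * l)%:R *: d).
    have [D DE] : exists D : R, D = (j - i)%:R by exists (j - i)%:R.
    have D1 : 1 <= D by rewrite DE ler1n subn_gt0.
    have Dm : 6 * D <= m%:R.
      rewrite DE -natrM ler_nat /m leq_mul2l orFb.
      exact: leq_trans (leq_subr _ _) (ltnW jJ).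
    have nD : n%:R <= n%:R * D by rewrite ler_peMr // ler0n.
    have nDm : n%:R * (6 * D) <= n%:R * m%:R by rewrite ler_wpM2l // ler0n.
    have pE : enorm (p j - p i) = 600 * (n%:R * D).
      have -> : p j - p i = (600 * (n%:R * D)) *: d.
        rewrite DE /p /k (natrB _ (ltnW ij)) !natrM; apply/rowP => l; rewrite !mxE; ring.
      by rewrite enormZ d1 mulr1 ger0_norm; [reflexivity | lra].
    have tele (f g h : G) : f + ((g - f) + (h - g)) = h.
      by rewrite addrA [f + _]addrC subrK addrC subrK.
    have zc (z c : 'rV[int]_n) : enorm (intvec R z) <= s -> enorm (intvec R c) <= r ->
        enorm (intvec R (z + c)) <= 229 * n%:R.
      by move=> zs cr; rewrite intvecD; apply: le_trans (enormD _ _) _; lra.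
    apply: (@torus_separated R K n (3 * n)%:R (229 * n%:R) (p j) (p i) wj wi
              (zv + cv) (zu + cu) K1 wjx wix (zc _ _ zvr cvr) (zc _ _ zur cur)).
    + by rewrite !intvecD wiE wjE zuE cuE zvE cvE !tele.
    + by rewrite pE (natrM _ 3 n); lra.
    + by rewrite pE (natrM _ 3 n) KR; lra.
  - have Tcard : (#|{: T}| < 2 ^ L)%N.
      rewrite /T card_prod card_mx card_ffun !card_ord mul1n.
      have -> : (Zp_trunc K).+2 = K by rewrite Zp_cast.
      by rewrite -[(2 * M).+1]addn1; apply: card_params => //; rewrite /K /k mE.
    have b0 : (0 < b)%N by apply/card_gt0P; exists 0.
    have := @pow_decay (4 * b) a (4 * 5 ^ n) L; rewrite -/J => decay.
    have {}decay : ((4 * b - a) ^ J * 2 ^ L <= (4 * b) ^ J)%N.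
      by apply: decay; [rewrite muln_gt0 expn_gt0 | rewrite -mulnA leq_mul2l ba].
    have [z0|zp] := posnP ((4 * b - a) ^ J).
      by rewrite z0 muln0 expn_gt0 muln_gt0 b0.
    by apply: leq_trans decay; rewrite mulnC ltn_pmul2l.
exists (fun z => intvec 'Z_K z \in I); split.
  move=> z w zI wI zw; rewrite ltNge; apply/negP => zwr.
  have /negP := Iindep _ _ wI zI; apply; rewrite /e; apply/andP; split.
    apply/eqP => /esym wz; move/negP: zw; apply; apply/eqP.
    apply: (torus_inj (R := R) K1 wz); apply: le_lt_trans zwr _.
    lra.
  by apply/torus_ballP; exists (z - w) => //; rewrite intvecB.
move=> x u u1.
have [X [U XU]] := approx_line k x m0 u1.
pose t : T := (intvec 'Z_K X, [ffun i => U i]).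
have YE j : Y t j = intvec 'Z_K (X + displacement R M m U j).
  rewrite /Y intvecD /=; congr (_ + intvec _ _).
  by apply/rowP => i; rewrite !mxE ffunE.
have jm j : (j < J)%N -> (6 * j < m)%N by rewrite /m; lia.
have Pt : P t.
  apply/asboolP; exists x, u; split=> // j jJ.
  by exists (X + displacement R M m U j) => //; apply: XU; rewrite ltnW ?jm.
have [j jJ [v vC vI]] := Ihit t Pt.
move: vC; rewrite finset.in_set YE => /torus_ballP [z zv zs].
exists (6 * j)%N; first by rewrite -mE jm.
exists (X + displacement R M m U j + z); first by rewrite intvecD zv addrC subrK.
rewrite intvecD addrAC; apply: le_trans (enormD _ _) _.
have := XU j (ltnW (jm j jJ)); rewrite !natrM -/M; lra.
Qed.

(** * The colouring *)

Local Open Scope classical_set_scope.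
Local Open Scope ring_scope.

Lemma edist_line (R : realType) (a b : R) :
  edist (const_mx a : 'rV[R]_1) (const_mx b) = `|a - b|.
Proof. by rewrite /edist /enorm big_ord1 !mxE sqrtr_sqr. Qed.

(** The squared distance from p_j to p_0 + j (p_1 - p_0) is a combination of the
    squared mutual distances of p_0, p_1 and p_j (Stewart's theorem), and it
    vanishes because these are j ^ 2, (j - 1) ^ 2 and 1. *)
Lemma line_rigid (R : realType) n m (p : nat -> 'rV[R]_n) : (1 < m)%N ->
  (forall i j, (i < m)%N -> (j < m)%N -> edist (p i) (p j) = `|i%:R - j%:R|) ->
  forall j, (j < m)%N -> p j = p 0%N + j%:R *: (p 1%N - p 0%N).
Proof.
move=> m1 pd j jm.
have sq a b : (a < m)%N -> (b < m)%N ->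
    \sum_i (p a 0 i - p b 0 i) ^+ 2 = (a%:R - b%:R) ^+ 2.
  move=> am bm; rewrite -[RHS]real_normK ?num_real // -pd // sqr_enorm.
  by apply: eq_bigr => i _; rewrite !mxE.
have m0 : (0 < m)%N by apply: ltn_trans m1.
apply/eqP; rewrite -subr_eq0; apply/eqP/enorm_eq0/eqP; rewrite -sqrf_eq0 sqr_enorm.
have -> : \sum_i (p j - (p 0%N + j%:R *: (p 1%N - p 0%N))) 0 i ^+ 2 =
    (1 - j%:R) * \sum_i (p j 0 i - p 0%N 0 i) ^+ 2 + j%:R * \sum_i (p j 0 i - p 1%N 0 i) ^+ 2
    + j%:R * (j%:R - 1) * \sum_i (p 1%N 0 i - p 0%N 0 i) ^+ 2.
  rewrite !mulr_sumr -!big_split /=; apply: eq_bigr => i _; rewrite !mxE; ring.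
by rewrite !sq //; apply/eqP; ring.
Qed.

(** Red points lie within 0.42 of a centre.  Those of the same centre are at
    distance at most 0.84, those of different centres at distance more than
    1.9 - 0.84 > 1. *)
Lemma not_arrow_ell (R : realType) n m : (0 < n)%N -> (1536 * n ^ 2 * 5 ^ n <= m)%N ->
  not_arrow n (ell R 2) (ell R m).
Proof.
move=> n0 mbig; have [P [sepP hitP]] := exists_hitting_packing R n0.
pose k : R := (100 * n)%:R.
pose red (x : 'rV[R]_n) := exists2 z, P z & enorm (intvec R z - k *: x) <= (42 * n)%:R.
have nR : 1 <= n%:R :> R by rewrite ler1n.
have kE : k = 100 * n%:R by rewrite /k natrM.
exists (fun x => if `[< red x >] then Red else Blue); split.
- move=> [A [[f [fd <-]] Ared]].
  have S0 : ell R 2 (const_mx 0%:R) by exists 0%N.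
  have S1 : ell R 2 (const_mx 1%:R) by exists 1%N.
  have redf s : ell R 2 s -> red (f s).
    move=> es; have := Ared (f s); case: asboolP => // _ h.
    by have /h : (f @` ell R 2) (f s) by exists s.
  have [z Pz zx] := redf _ S0; have [w Pw wy] := redf _ S1.
  have := fd _ _ S0 S1; rewrite edist_line sub0r normrN1 /edist.
  set x := f _ in zx *; set y := f _ in wy * => xy1.
  have kxy : enorm (k *: x - k *: y) = 100 * n%:R.
    by rewrite -scalerBr enormZ xy1 mulr1 ger0_norm // kE.
  move: zx wy; rewrite natrM => zx wy.
  have [zw|zw] := eqVneq z w.
    have := enormD (k *: x - intvec R z) (intvec R w - k *: y).
    by rewrite zw addrA subrK kxy (enormBC (k *: x)) -{1}zw; lra.
  have := sepP _ _ Pz Pw zw; rewrite natrM intvecB.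
  have -> : intvec R z - intvec R w =
      (intvec R z - k *: x) + (k *: x - k *: y) + (k *: y - intvec R w).
    by rewrite !addrA !subrK.
  have := enormD ((intvec R z - k *: x) + (k *: x - k *: y)) (k *: y - intvec R w).
  have := enormD (intvec R z - k *: x) (k *: x - k *: y).
  by rewrite kxy (enormBC (k *: y)); lra.
- move=> [A [[f [fd <-]] Ablue]].
  pose p j : 'rV[R]_n := f (const_mx j%:R).
  have Sj j : (j < m)%N -> ell R m (const_mx j%:R) by exists j.
  have m1 : (1 < m)%N.
    apply: leq_trans mbig.
    have : (0 < n ^ 2 * 5 ^ n)%N by rewrite muln_gt0 !expn_gt0 n0.
    lia.
  have pd i j : (i < m)%N -> (j < m)%N -> edist (p i) (p j) = `|i%:R - j%:R|.
    by move=> im jm; rewrite fd ?edist_line //; exact: Sj.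
  have line := line_rigid m1 pd.
  have u1 : enorm (p 1%N - p 0%N) = 1.
    have := pd 1%N 0%N m1 (ltnW m1); rewrite /edist => ->.
    by rewrite subr0 normr1.
  have [j jm [z Pz zx]] := hitP (p 0%N) _ u1.
  have {}jm : (j < m)%N by apply: leq_trans mbig.
  have := Ablue (p j); case: asboolP => [_ h|+ _]; last first.
    by apply; exists z => //; rewrite line.
  by have /h : (f @` ell R m) (p j) by exists (const_mx j%:R) => //; exact: Sj.
Qed.

Theorem mainTheorem5 (R : realType) :
  exists eps : nat -> R,
    (eps @ \oo --> (0 : R)) /\
    (forall n m : nat, (0 < n)%N -> (5 + eps n) ^+ n < m%:R ->
       not_arrow n (ell R 2) (ell R m)).
Proof.
exists (fun n => 5 * (expR (28 * Num.sqrt (n%:R^-1)) - 1)); split.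
  have inv0 : (fun n : nat => n%:R^-1 : R) @ \oo --> (0 : R).
    by rewrite -(cvg_shiftS (fun n : nat => n%:R^-1 : R)); exact: cvg_harmonic.
  have sqrt0 : (fun n : nat => Num.sqrt (n%:R^-1) : R) @ \oo --> Num.sqrt (0 : R).
    by apply: continuous_cvg inv0; exact: sqrt_continuous.
  rewrite sqrtr0 in sqrt0.
  have exp1 : (fun n : nat => expR (28 * Num.sqrt (n%:R^-1)) : R) @ \oo --> expR (28 * 0 : R).
    apply: (@continuous_cvg _ _ _ _ _ _ expR); first exact: continuous_expR.
    exact: cvgMr sqrt0.
  rewrite mulr0 expR0 in exp1.
  rewrite -[X in _ --> X](mulr0 5) -(subrr 1).
  by apply: cvgMr; apply: cvgB exp1 _; exact: cvg_cst.
move=> n m n0 epsm; apply: not_arrow_ell => //.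
rewrite -(ler_nat R); apply: le_trans (ltW epsm).
have nR : 0 < n%:R :> R by rewrite ltr0n.
set s := Num.sqrt _.
have s0 : 0 <= s by exact: sqrtr_ge0.
have s2 : s ^+ 2 * n%:R = 1 by rewrite sqr_sqrtr ?invr_ge0 // mulVf // gt_eqF.
have -> : 5 + 5 * (expR (28 * s) - 1) = 5 * expR (28 * s) by ring.
(* exp (28 s) ^ n = exp (7 sqrt n) ^ 4 >= (7 sqrt n) ^ 4 = 2401 n ^ 2 *)
rewrite exprMn natrM natrX mulrC ler_wpM2l ?exprn_ge0 //.
have -> : expR (28 * s) ^+ n = expR (7 * s * n%:R) ^+ 4.
  by rewrite -!expRM_natl; congr expR; ring.
apply: le_trans (_ : (7 * s * n%:R) ^+ 4 <= _).
  have -> : (7 * s * n%:R) ^+ 4 = 2401 * (s ^+ 2 * n%:R) ^+ 2 * n%:R ^+ 2 by ring.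
  rewrite s2 expr1n mulr1 natrM natrX; apply: ler_wpM2r; first exact: exprn_ge0 (ltW nR).
  by rewrite ler_nat.
rewrite lerXn2r ?nnegrE ?expR_ge0 //; first by rewrite !mulr_ge0.
by apply: le_trans (expR_ge1Dx _); rewrite lerDr.
Qed.
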